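(* Consider a real system $$\dot x=-y+\sum_{k+j+l\ge2}A_{kjl}x^ky^ju^l,\quad \dot y=x+\sum_{k+j+l\ge2}B_{kjl}x^ky^ju^l,\quad \dot u=-du+\sum_{k+j+l\ge2}d_{kjl}x^ky^ju^l,$$ with real coefficients and $d\in\mathbb{R}$, $d\ne0$. Let $p_j,q_j$ ($j\ge1$) be the normal form constants of its reduced complex system on the center manifold, and let $p'_j,q'_j$ ($j\ge1$) be the constants defined by the three-dimensional formal series $f$ and $g$ (all as defined in the context). Put $p_0=q_0=p'_0=q'_0=0$. If there is a positive integer $m$ such that $$p_0=q_0=p_1=q_1=\cdots=p_{m-1}=q_{m-1}=0,$$ then $$p'_0=q'_0=p'_1=q'_1=\cdots=p'_{m-1}=q'_{m-1}=0,\qquad p_m=p'_m,\quad q_m=q'_m .$$ The converse also holds: if $p'_0=q'_0=\cdots=p'_{m-1}=q'_{m-1}=0$, then $p_0=q_0=\cdots=p_{m-1}=q_{m-1}=0$, $p_m=p'_m$ and $q_m=q'_m$. Correspondingly, the origin of the real system is an isochronous center (on the center manifold) if and only if $p'_k=q'_k=0$ for all $k=1,2,3,\dots$.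
   Context: Let $\mathbf{i}=\sqrt{-1}$; series are treated as formal power series. Concomitant complex system: the substitution $z=x+\mathbf{i}y$, $w=x-\mathbf{i}y$, $t=-T\mathbf{i}$ turns the real system into $$\frac{dz}{dT}=Z(z,w,u)=z+\cdots,\quad \frac{dw}{dT}=-W(z,w,u)=-w-\cdots,\quad \frac{du}{dT}=U(z,w,u)=\mathbf{i}du+\cdots,$$ where dots denote terms of degree $\ge2$. Constants $p'_m,q'_m$: there is a unique formal series $f(z,w,u)=z+\sum_{\alpha+\beta+\gamma\ge2}c_{\alpha\beta\gamma}z^\alpha w^\beta u^\gamma$ with $c_{k+1,k,0}=0$ for all $k\ge1$, and unique constants $p'_m$, such that $$\frac{\partial f}{\partial z}Z-\frac{\partial f}{\partial w}W+\frac{\partial f}{\partial u}U-f=z\sum_{m\ge1}p'_m(zw)^m;$$ similarly there is a unique formal series $g(w,z,u)=w+\sum_{\alpha+\beta+\gamma\ge2}e_{\alpha\beta\gamma}w^\alpha z^\beta u^\gamma$ with $e_{k+1,k,0}=0$ for all $k\ge1$, and unique constants $q'_m$, such that $$\frac{\partial g}{\partial z}Z-\frac{\partial g}{\partial w}W+\frac{\partial g}{\partial u}U+g=-w\sum_{m\ge1}q'_m(zw)^m.$$ Reduced complex system: the center manifold has the expansion $u=\tilde u(z,w)$, the unique formal power series without constant and linear terms satisfying $\tilde u_z\,Z(z,w,\tilde u)-\tilde u_w\,W(z,w,\tilde u)=U(z,w,\tilde u)$ (equivalently, $u=u(x,y)=u_2(x,y)+\cdots$ in real coordinates, with $u_2$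 quadratic). The reduced complex system is $\frac{dz}{dT}=Z(z,w,\tilde u(z,w))$, $\frac{dw}{dT}=-W(z,w,\tilde u(z,w))$; it is the concomitant system of the planar real system obtained by substituting $u=u(x,y)$ in the first two real equations. Constants $p_j,q_j$: for the reduced complex system there are unique formal series $\xi=z+\sum_{k+j\ge2}c_{kj}z^kw^j$, $\eta=w+\sum_{k+j\ge2}d_{kj}w^kz^j$ with $c_{k+1,k}=d_{k+1,k}=0$ for $k\ge1$, and unique constants $p_j,q_j$, such that along the reduced system $$\frac{d\xi}{dT}=\xi+\sum_{j\ge1}p_j\xi^{j+1}\eta^j,\qquad \frac{d\eta}{dT}=-\eta-\sum_{j\ge1}q_j\eta^{j+1}\xi^j .$$ Isochronous center: the origin of a planar complex system of this form (and of its real counterpart) is called an isochronous center if $p_k=q_k=0$ for all $k\ge1$; the origin of the three-dimensional system is called an isochronous center (on the center manifold) if the origin of its reduced system is one. *)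

(* Defs.v *)
From HB Require Import structures.
From mathcomp Require Import all_boot all_order all_algebra.
From mathcomp Require Import boolp reals complex.
From mathcomp Require Import mpoly.

Set Implicit Arguments.
Unset Strict Implicit.
Unset Printing Implicit Defensive.

Import GRing.Theory Num.Theory.

Local Open Scope ring_scope.
Local Open Scope complex_scope.

(* Formal power series in n commuting variables, given by their coefficients. *)
Definition mseries (n : nat) (R : comNzRingType) : Type := 'X_{1..n} -> R.

Reserved Notation "{ 'mseries' R [ n ] }" (format "{ 'mseries'  R [ n ] }").
Notation "{ 'mseries' R [ n ] }" := (mseries n R) : type_scope.

Section SeriesRing.
Context (n : nat) (R : comNzRingType).
Implicit Types (f g h : {mseries R[n]}) (m : 'X_{1..n}) (c : R).

Lemma msP f g : (forall m, f m = g m) -> f = g.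
Proof. exact: funext. Qed.

HB.instance Definition _ := gen_eqMixin {mseries R[n]}.
HB.instance Definition _ := gen_choiceMixin {mseries R[n]}.

Definition mszero : {mseries R[n]} := fun=> 0.
Definition msopp f : {mseries R[n]} := fun m => - f m.
Definition msadd f g : {mseries R[n]} := fun m => f m + g m.

Lemma msaddA : associative msadd.
Proof. by move=> f g h; apply: msP => m; exact: addrA. Qed.

Lemma msaddC : commutative msadd.
Proof. by move=> f g; apply: msP => m; exact: addrC. Qed.

Lemma msadd0 : left_id mszero msadd.
Proof. by move=> f; apply: msP => m; exact: add0r. Qed.

Lemma msaddN : left_inverse mszero msopp msadd.
Proof. by move=> f; apply: msP => m; exact: addNr. Qed.

HB.instance Definition _ := GRing.isZmodule.Build {mseries R[n]}
  msaddA msaddC msadd0 msaddN.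

Definition msone : {mseries R[n]} := fun m => (m == 0%MM)%:R.

Definition msmul f g : {mseries R[n]} := fun m =>
  \sum_(k : 'X_{1..n < (mdeg m).+1, (mdeg m).+1} | m == (k.1 + k.2)%MM)
     f k.1 * g k.2.

Definition msscale c f : {mseries R[n]} := fun m => c * f m.

(* Truncation to degree < b, used to inherit the ring axioms of {mpoly R[n]}. *)
Definition mstrunc (b : nat) f : {mpoly R[n]} :=
  \sum_(k : 'X_{1..n < b}) f k *: 'X_[k].

Lemma mstruncE b f m : (mdeg m < b)%N -> (mstrunc b f)@_m = f m.
Proof. by move=> lt_mb; rewrite /mstrunc mcoeff_mpoly. Qed.

Lemma msmul_coefE f g (p q : {mpoly R[n]}) m :
    (forall k, (mdeg k <= mdeg m)%N -> f k = p@_k) ->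
    (forall k, (mdeg k <= mdeg m)%N -> g k = q@_k) ->
  msmul f g m = (p * q)@_m.
Proof.
move=> fp gq; rewrite mcoeffM; apply: eq_bigr => -[k l] /= _.
by rewrite fp ?gq // -ltnS bmdeg.
Qed.

Lemma msmulE b f g m : (mdeg m < b)%N ->
  msmul f g m = (mstrunc b f * mstrunc b g)@_m.
Proof.
move=> lt_mb; apply: msmul_coefE => k le_km;
  by rewrite mstruncE // (leq_ltn_trans le_km).
Qed.

Lemma msmulA : associative msmul.
Proof.
move=> f g h; apply: msP => m; pose T := mstrunc (mdeg m).+1.
rewrite (msmul_coefE (p := T f) (q := T g * T h)); first last.
- by move=> k le_km; rewrite (msmulE _ _ (b := (mdeg m).+1)).
- by move=> k le_km; rewrite mstruncE.
rewrite (msmul_coefE (p := T f * T g) (q := T h)) ?mulrA //.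
- by move=> k le_km; rewrite (msmulE _ _ (b := (mdeg m).+1)).
- by move=> k le_km; rewrite mstruncE.
Qed.

Lemma msmulC : commutative msmul.
Proof.
by move=> f g; apply: msP => m; rewrite !(msmulE _ _ (ltnSn _)) mulrC.
Qed.

Lemma msmul1 : left_id msone msmul.
Proof.
move=> f; apply: msP => m.
rewrite (msmul_coefE (p := 1) (q := mstrunc (mdeg m).+1 f)).
- by rewrite mul1r mstruncE.
- by move=> k _; rewrite mcoeff1.
- by move=> k le_km; rewrite mstruncE.
Qed.

Lemma msmulDl : left_distributive msmul +%R.
Proof.
move=> f g h; apply: msP => m.
transitivity (msmul f h m + msmul g h m); last by [].
by rewrite /msmul -big_split; apply: eq_bigr => k _; exact: mulrDl.
Qed.

Lemma msone_neq0 : msone != 0.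
Proof.
apply/eqP => /(congr1 (fun f : {mseries R[n]} => f 0%MM)).
by rewrite /msone eqxx => /eqP; rewrite oner_eq0.
Qed.

HB.instance Definition _ := GRing.Zmodule_isComNzRing.Build {mseries R[n]}
  msmulA msmulC msmul1 msmulDl msone_neq0.

Lemma msscaleA c1 c2 f : msscale c1 (msscale c2 f) = msscale (c1 * c2) f.
Proof. by apply: msP => m; rewrite /msscale mulrA. Qed.

Lemma msscale1 : left_id 1 msscale.
Proof. by move=> f; apply: msP => m; exact: mul1r. Qed.

Lemma msscaleDr : right_distributive msscale +%R.
Proof. by move=> c f g; apply: msP => m; exact: mulrDr. Qed.

Lemma msscaleDl f : {morph msscale^~ f : c1 c2 / c1 + c2}.
Proof. by move=> c1 c2; apply: msP => m; exact: mulrDl. Qed.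

HB.instance Definition _ := GRing.Zmodule_isLmodule.Build R {mseries R[n]}
  msscaleA msscale1 msscaleDr msscaleDl.

Definition msX (i : 'I_n) : {mseries R[n]} := fun m => (m == U_(i)%MM)%:R.

Definition msderiv (i : 'I_n) f : {mseries R[n]} := fun m =>
  f (m + U_(i))%MM *+ (m i).+1.

(* f and g have the same terms of degree 0 and 1. *)
Definition eq_lin f g : Prop := forall m, (mdeg m < 2)%N -> f m = g m.

(* \sum_(j >= 1) F j. Only meaningful when F j has no term of degree < j, so *)
(* that the terms with j > mdeg m do not contribute to the coefficient at m. *)
Definition mssum (F : nat -> {mseries R[n]}) : {mseries R[n]} := fun m =>
  \sum_(1 <= j < (mdeg m).+1) F j m.

End SeriesRing.

Arguments msX {n R} i.

(* f(h_0, ..., h_(n-1)). Only meaningful when the h_i have no constant term, *)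
(* so that \prod_i h_i ^+ k i has no term of degree < mdeg k.                *)
Definition mscomp (n n' : nat) (R : comNzRingType) (h : n.-tuple {mseries R[n']})
    (f : {mseries R[n]}) : {mseries R[n']} := fun m =>
  \sum_(k : 'X_{1..n < (mdeg m).+1})
     f k * (\prod_(i < n) tnth h i ^+ (k : 'X_{1..n}) i) m.

Section System.
Context (R : realType).
Local Notation C := R[i].

Definition complexify (n : nat) (f : {mseries R[n]}) : {mseries C[n]} :=
  fun m => (f m)%:C.

(* A real series in x, y, u, rewritten in z = x + iy, w = x - iy and u. *)
Definition to_zwu (f : {mseries R[3]}) : {mseries C[3]} :=
  mscomp [tuple (2%:R)^-1 *: (msX 0 + msX 1);
                (2%:R * 'i)^-1 *: (msX 0 - msX 1);
                msX 2]
    (complexify f).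

(* Right-hand sides of the concomitant system dz/dT = Z, dw/dT = - W,        *)
(* du/dT = U of dx/dt = X, dy/dt = Y, du/dt = V; as t = - T i, one has       *)
(* d/dT = - i d/dt.                                                          *)
Definition concZ (X Y : {mseries R[3]}) : {mseries C[3]} :=
  - 'i *: (to_zwu X + 'i *: to_zwu Y).
Definition concW (X Y : {mseries R[3]}) : {mseries C[3]} :=
  'i *: (to_zwu X - 'i *: to_zwu Y).
Definition concU (V : {mseries R[3]}) : {mseries C[3]} := - 'i *: to_zwu V.

Section Spatial.
Variables Z W U : {mseries C[3]}.

Definition ddT3 (f : {mseries C[3]}) : {mseries C[3]} :=
  msderiv 0 f * Z - msderiv 1 f * W + msderiv 2 f * U.

Local Notation z := (msX 0 : {mseries C[3]}).
Local Notation w := (msX 1 : {mseries C[3]}).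

Definition f_constants (p' : nat -> C) : Prop :=
  p' 0 = 0 /\
  exists f : {mseries C[3]},
    [/\ eq_lin f z,
        forall k, (0 < k)%N -> f [multinom [:: k.+1; k; 0]%N] = 0 &
        ddT3 f - f = z * mssum (fun m => p' m *: (z * w) ^+ m)].

(* Exponents are listed in the order z, w, u, so e_{k+1,k,0} is the          *)
(* coefficient of z^k w^(k+1).                                               *)
Definition g_constants (q' : nat -> C) : Prop :=
  q' 0 = 0 /\
  exists g : {mseries C[3]},
    [/\ eq_lin g w,
        forall k, (0 < k)%N -> g [multinom [:: k; k.+1; 0]%N] = 0 &
        ddT3 g + g = - w * mssum (fun m => q' m *: (z * w) ^+ m)].

(* f(z, w, ut(z, w)) *)
Definition on_manifold (ut : {mseries C[2]}) (f : {mseries C[3]}) :=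
  mscomp [tuple msX 0; msX 1; ut] f.

Definition center_manifold (ut : {mseries C[2]}) : Prop :=
  eq_lin ut 0 /\
  msderiv 0 ut * on_manifold ut Z - msderiv 1 ut * on_manifold ut W =
    on_manifold ut U.

End Spatial.

Section Planar.
Variables Z W : {mseries C[2]}.

Definition ddT2 (f : {mseries C[2]}) : {mseries C[2]} :=
  msderiv 0 f * Z - msderiv 1 f * W.

Definition normal_form_constants (p q : nat -> C) : Prop :=
  p 0 = 0 /\ q 0 = 0 /\
  exists xi eta : {mseries C[2]},
    [/\ eq_lin xi (msX 0) /\ eq_lin eta (msX 1),
        forall k, (0 < k)%N -> xi [multinom [:: k.+1; k]%N] = 0,
        forall k, (0 < k)%N -> eta [multinom [:: k; k.+1]%N] = 0,
        ddT2 xi = xi + mssum (fun j => p j *: (xi ^+ j.+1 * eta ^+ j)) &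
        ddT2 eta = - eta - mssum (fun j => q j *: (eta ^+ j.+1 * xi ^+ j))].

Definition planar_isochronous_center : Prop :=
  exists p q : nat -> C, normal_form_constants p q /\
    forall k, (0 < k)%N -> p k = 0 /\ q k = 0.

End Planar.

Definition isochronous_center (X Y V : {mseries R[3]}) : Prop :=
  exists ut : {mseries C[2]},
    center_manifold (concZ X Y) (concW X Y) (concU V) ut /\
    planar_isochronous_center (on_manifold ut (concZ X Y))
                              (on_manifold ut (concW X Y)).

End System.

(* Main.v *)
Require Import Defs.
From HB Require Import structures.
From mathcomp Require Import all_boot all_order all_algebra.
From mathcomp Require Import boolp reals complex.
From mathcomp Require Import mpoly.
From mathcomp Require Import ring zify.

Set Implicit Arguments.
Unset Strict Implicit.
Unset Printing Implicit Defensive.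

Import GRing.Theory Num.Theory.

Local Open Scope ring_scope.

(* Restricting f to the center manifold gives, by the chain rule, a planar    *)
(* series F = z + ... with X F - F = z sum_m p'_m (zw)^m, where X is the      *)
(* reduced vector field. If p_j = q_j = 0 for j < n, then xi and eta are      *)
(* eigenvectors of X for the eigenvalues 1 and -1 up to terms of degree       *)
(* 2n + 1. If also p'_j = 0 for j < n, then D = F - xi has no term of degree  *)
(* < 2, and X D - D = (p'_n - p_n) z^(n+1) w^n up to terms of degree 2n + 2.  *)
(* The lowest terms of D must be resonant, so subtracting combinations of     *)
(* monomials xi^(j+1) eta^j raises the order of D to 2n + 1 without changing  *)
(* X D - D up to degree 2n + 1; but X - 1 kills the resonant term             *)
(* z^(n+1) w^n, hence p'_n = p_n. The same holds for g, and the theorem       *)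
(* follows by induction on n.                                                 *)

(** The linear part of the reduced field X is z d/dz - w d/dw, which multiplies z^a w^b by a - b.
    Hence X - 1 cannot create z^(n+1) w^n out of terms of degree 2n + 1; only resonant terms of
    lower degree could do so, through the nonlinear part of X, and the vanishing of the earlier p_j,
    q_j rules this out. This is [eigen_obstruction].

    Consequently the n-th constant is intrinsic: every series tangent to z (or w) that is an
    eigenvector of X up to a multiple of the resonant monomial of degree 2n + 1, modulo degree 2n +
    2, gives the same multiple ([normal_form_p], [normal_form_q]). The restrictions of f and g are
    such series, by [ddT2_on_manifold]. The comparison at level n assumes that both pairs of
    sequences vanish below n, so strong induction carries the vanishing from either pair to the
    other.

    Estimates are made modulo powers of the ideal of the variables ([msord]), where identities
    between series reduce to identities between polynomials. *)

Section SeriesAlgebra.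
Context (n : nat) (R : comNzRingType).
Implicit Types (f g : {mseries R[n]}) (m : 'X_{1..n}) (c : R).

Lemma msZE c f m : (c *: f) m = c * f m.
Proof. by []. Qed.

Lemma msZAl c f g : c *: (f * g) = c *: f * g.
Proof.
apply: msP => m; rewrite msZE /(_ * g) /= /msmul mulr_sumr.
by apply: eq_bigr => k _; rewrite mulrA.
Qed.

HB.instance Definition _ :=
  GRing.Lmodule_isLalgebra.Build R {mseries R[n]} msZAl.

Lemma msDE f g m : (f + g) m = f m + g m.
Proof. by []. Qed.

Lemma msNE f m : (- f) m = - f m.
Proof. by []. Qed.

Lemma msBE f g m : (f - g) m = f m - g m.
Proof. by []. Qed.

Lemma msME f g m :
  (f * g) m = \sum_(k : 'X_{1..n < (mdeg m).+1, (mdeg m).+1}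
                      | m == (k.1 + k.2)%MM) f k.1 * g k.2.
Proof. by []. Qed.

Lemma ms_sumE (I : Type) (r : seq I) (P : pred I) (F : I -> {mseries R[n]}) m :
  (\sum_(i <- r | P i) F i) m = \sum_(i <- r | P i) F i m.
Proof. exact: (big_morph (fun f => f m)). Qed.

(** This is the b-th power of the ideal generated by the variables; congruence up to order b is
    written [msord b (f - g)]. *)
Definition msord (b : nat) f : Prop := forall m, (mdeg m < b)%N -> f m = 0.

Lemma msord_le a b f : (a <= b)%N -> msord b f -> msord a f.
Proof. by move=> le_ab fb m lt_ma; apply: fb; apply: leq_trans le_ab. Qed.

Lemma msordD b f g : msord b f -> msord b g -> msord b (f + g).
Proof. by move=> fb gb m lt_mb; rewrite msDE fb // gb // addr0. Qed.

Lemma msordN b f : msord b f -> msord b (- f).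
Proof. by move=> fb m lt_mb; rewrite msNE fb // oppr0. Qed.

Lemma msordB b f g : msord b f -> msord b g -> msord b (f - g).
Proof. by move=> fb /msordN; exact: msordD. Qed.

Lemma msordZ b c f : msord b f -> msord b (c *: f).
Proof. by move=> fb m lt_mb; rewrite msZE fb // mulr0. Qed.

Lemma msord_sum b (I : Type) (r : seq I) (P : pred I)
    (F : I -> {mseries R[n]}) :
  (forall i, P i -> msord b (F i)) -> msord b (\sum_(i <- r | P i) F i).
Proof.
by move=> Fb; elim/big_rec: _ => // i f Pi fb; apply: msordD => //; exact: Fb.
Qed.

Lemma msordM a b f g : msord a f -> msord b g -> msord (a + b) (f * g).
Proof.
move=> fa gb m lt_mab; rewrite msME big1 // => -[[k ?] [l ?]] /= /eqP def_m.
have [lt_ka|le_ak] := ltnP (mdeg k) a; first by rewrite fa // mul0r.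
by rewrite gb ?mulr0 //; move: lt_mab; rewrite def_m mdegD; lia.
Qed.

Lemma msordX b f k : msord b f -> msord (k * b) (f ^+ k).
Proof.
by move=> fb; elim: k => [|k IHk] //; rewrite exprS mulSn; apply: msordM.
Qed.

Lemma msord_eqM a b f f' g g' : msord a f' -> msord a.+1 (f - f') ->
    msord b g -> msord b.+1 (g - g') ->
  msord (a + b).+1 (f * g - f' * g').
Proof.
move=> f'a ff' gb gg'.
have ->: f * g - f' * g' = (f - f') * g + f' * (g - g').
  by rewrite mulrBl mulrBr addrA subrK.
by apply: msordD; [rewrite -addSn|rewrite -addnS]; apply: msordM.
Qed.

Lemma msord_eq b f g : msord b g -> msord b.+1 (f - g) -> msord b f.
Proof.
by move=> gb fg; rewrite -(subrK g f); apply: msordD => //;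
  exact: msord_le fg.
Qed.

Lemma msord_eqX a f f' k : msord a f' -> msord a.+1 (f - f') ->
  msord (k * a).+1 (f ^+ k - f' ^+ k).
Proof.
move=> f'a ff'; have fa := msord_eq f'a ff'.
elim: k => [|k IHk]; first by rewrite subrr.
rewrite !exprS mulSn; apply: msord_eqM => //; exact: msordX.
Qed.

Lemma eq_linE f g : eq_lin f g <-> msord 2 (f - g).
Proof.
split=> fg m lt_m2; first by rewrite msBE fg // subrr.
by apply/eqP; rewrite -subr_eq0 -msBE fg.
Qed.

Lemma msord_lt_eq f g : (forall b, msord b (f - g)) -> f = g.
Proof.
move=> fg; apply: msP => m; apply/eqP; rewrite -subr_eq0 -msBE.
by rewrite (fg (mdeg m).+1).
Qed.

Lemma msordXi (i : 'I_n) : msord 1 (msX i : {mseries R[n]}).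
Proof.
move=> m; rewrite ltnS leqn0 mdeg_eq0 => /eqP ->.
rewrite /msX; case: eqP => // /(congr1 (@mdeg n)).
by rewrite mdeg0 mdeg1.
Qed.

(** Polynomials form a subring that is dense for the filtration ([mstrunc_ord]), which lets ring and
    derivation identities be imported from [{mpoly R[n]}]. *)
Definition mspoly (p : {mpoly R[n]}) : {mseries R[n]} := fun m => p@_m.

Lemma mspoly_is_zmod_morphism : zmod_morphism mspoly.
Proof. by move=> p q; apply: msP => m; exact: mcoeffB. Qed.

Lemma mspoly_is_monoid_morphism : monoid_morphism mspoly.
Proof.
split=> [|p q]; apply: msP => m; first by rewrite /mspoly mcoeff1.
by symmetry; exact: msmul_coefE.
Qed.

HB.instance Definition _ := GRing.isZmodMorphism.Build
  {mpoly R[n]} {mseries R[n]} mspoly mspoly_is_zmod_morphism.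
HB.instance Definition _ := GRing.isMonoidMorphism.Build
  {mpoly R[n]} {mseries R[n]} mspoly mspoly_is_monoid_morphism.

Lemma mspolyZ c p : mspoly (c *: p) = c *: mspoly p.
Proof. by apply: msP => m; exact: mcoeffZ. Qed.

Lemma mspolyXU i : mspoly 'X_i = msX i.
Proof. by apply: msP => m; rewrite /mspoly mcoeffX eq_sym. Qed.

Lemma msX_prodE (k m : 'X_{1..n}) :
  (\prod_(i < n) (msX i : {mseries R[n]}) ^+ k i) m = (m == k)%:R.
Proof.
suff -> : \prod_(i < n) (msX i : {mseries R[n]}) ^+ k i = mspoly 'X_[k].
  by rewrite /mspoly mcoeffX eq_sym.
rewrite mpolyXE_id rmorph_prod; apply: eq_bigr => i _.
by rewrite rmorphXn -mspolyXU.
Qed.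

Lemma mstrunc_ord b f : msord b (f - mspoly (mstrunc b f)).
Proof. by move=> m lt_mb; rewrite msBE /mspoly mstruncE // subrr. Qed.

End SeriesAlgebra.

(** * Partial derivatives *)

Section Derivation.
Context (n : nat) (R : comNzRingType) (i : 'I_n).
Implicit Types (f g : {mseries R[n]}) (m : 'X_{1..n}) (c : R).

Lemma msderivD f g : msderiv i (f + g) = msderiv i f + msderiv i g.
Proof. by apply: msP => m; rewrite msDE /msderiv msDE mulrnDl. Qed.

Lemma msderivN f : msderiv i (- f) = - msderiv i f.
Proof. by apply: msP => m; rewrite msNE /msderiv msNE mulNrn. Qed.

Lemma msderivZ c f : msderiv i (c *: f) = c *: msderiv i f.
Proof. by apply: msP => m; rewrite msZE /msderiv msZE mulrnAr. Qed.

Lemma msderiv1 : msderiv i (1 : {mseries R[n]}) = 0.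
Proof.
apply: msP => m; rewrite /msderiv.
have -> : (1 : {mseries R[n]}) (m + U_(i))%MM = 0.
  by apply: (_ : _%:R = 0); rewrite -mdeg_eq0 mdegD mdeg1 addn1.
by rewrite mul0rn.
Qed.

Lemma msderivX j : msderiv i (msX j : {mseries R[n]}) = (i == j)%:R.
Proof.
rewrite -mspolyXU; apply: msP => m.
rewrite /msderiv -[LHS]mcoeff_deriv mderivX mnm1E eq_sym.
case: eqP => [->|_]; last by rewrite scale0r mcoeff0.
rewrite scale1r (_ : U_(j) - U_(j) = 0)%MM ?mpolyX0 ?mcoeff1 //.
by apply/mnmP => l; rewrite mnmBE mnm0E subnn.
Qed.

(** The coefficient at [m] only sees terms of degree at most [mdeg m + 1], so truncating there
    reduces the claim to the Leibniz rule for polynomials. *)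
Lemma msderivM f g :
  msderiv i (f * g) = msderiv i f * g + f * msderiv i g.
Proof.
apply: msP => m; pose T (h : {mseries R[n]}) := mstrunc (mdeg m).+2 h.
have derivT h k : (mdeg k <= mdeg m)%N -> msderiv i h k = (T h)^`M(i)@_k.
  move=> le_km; rewrite mcoeff_deriv mstruncE // mdegD mdeg1 addn1.
  by rewrite ltnS.
have coefT h k : (mdeg k <= mdeg m)%N -> h k = (T h)@_k.
  by move=> le_km; rewrite mstruncE // ltnW.
rewrite msDE {1}/msderiv [(f * g) _](msmulE (b := (mdeg m).+2)); last first.
  by rewrite mdegD mdeg1 addn1.
rewrite -mcoeff_deriv mderivM mcoeffD; congr (_ + _); symmetry.
- by apply: msmul_coefE => k; [exact: derivT|exact: coefT].
- by apply: msmul_coefE => k; [exact: coefT|exact: derivT].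
Qed.

Lemma msord_deriv b f : msord b.+1 f -> msord b (msderiv i f).
Proof.
move=> fb m lt_mb; rewrite /msderiv fb ?mul0rn //.
by rewrite mdegD mdeg1 addn1.
Qed.

(** The Euler operator x_i d/dx_i is diagonal on monomials; this later gives the eigenvalues of the
    linear part of the field. *)
Lemma msderivMX_E f m : (msderiv i f * msX i) m = f m *+ m i.
Proof.
have [mi0|mi_gt0] := posnP (m i).
  rewrite mi0 mulr0n msME big1 // => k /eqP def_m.
  rewrite [msX i _](_ : _ = 0) ?mulr0 // /msX; case: eqP => // def_k2.
  by have /mnmP/(_ i) := def_m; rewrite mi0 mnmDE def_k2 mnm1E eqxx addn1.
have def_m : m = (U_(i) + (m - U_(i)))%MM.
  apply/mnmP => j; rewrite mnmDE mnmBE mnm1E.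
  by case: eqP => [<-|//]; rewrite subnKC.
pose T := mstrunc (mdeg m).+2 f.
rewrite [LHS](msmul_coefE (p := T^`M(i)) (q := 'X_i)).
- rewrite {1}def_m mcoeffMX mcoeff_deriv mnmBE mnm1E eqxx subn1 prednK //.
  by rewrite addmC -def_m mstruncE.
- by move=> k le_km; rewrite mcoeff_deriv mstruncE // mdegD mdeg1 addn1 ltnS.
- by move=> k _; rewrite mcoeffX eq_sym.
Qed.

End Derivation.

(** * Substitution and the chain rule *)

Section Composition.
Context (n n' : nat) (R : comNzRingType) (h : n.-tuple {mseries R[n']}).
Implicit Types (f g : {mseries R[n]}) (p : {mpoly R[n]}) (c : R).

Lemma mscompD f g : mscomp h (f + g) = mscomp h f + mscomp h g.
Proof.
apply: msP => m; rewrite msDE /mscomp -big_split; apply: eq_bigr => k _.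
by rewrite msDE mulrDl.
Qed.

Lemma mscompZ c f : mscomp h (c *: f) = c *: mscomp h f.
Proof.
apply: msP => m; rewrite msZE /mscomp mulr_sumr; apply: eq_bigr => k _.
by rewrite msZE mulrA.
Qed.

Lemma mscompN f : mscomp h (- f) = - mscomp h f.
Proof. by rewrite -scaleN1r mscompZ scaleN1r. Qed.

Lemma mscompB f g : mscomp h (f - g) = mscomp h f - mscomp h g.
Proof. by rewrite mscompD mscompN. Qed.

Lemma mscomp0 : mscomp h 0 = 0.
Proof. by have := mscompB 0 0; rewrite !subrr. Qed.

Lemma msord_comp b f : msord b f -> msord b (mscomp h f).
Proof.
move=> fb m lt_mb; rewrite /mscomp big1 // => -[k /= lt_km] _.
by rewrite fb ?mul0r // (leq_trans lt_km).
Qed.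

Hypothesis h1 : forall i, msord 1 (tnth h i).

Definition mspoly_comp p : {mseries R[n']} :=
  mmap (GRing.in_alg {mseries R[n']}) (tnth h) p.

Lemma msord_prod (k : 'X_{1..n}) :
  msord (mdeg k) (\prod_(i < n) tnth h i ^+ k i).
Proof.
rewrite mdegE; elim/big_rec2: _ => [//|i b f _ fb].
by rewrite -[X in (X + _)%N]muln1; apply: msordM fb; apply: msordX.
Qed.

Lemma msord_poly_comp b p :
  (forall k, (mdeg k < b)%N -> p@_k = 0) -> msord b (mspoly_comp p).
Proof.
move=> pb; apply: msord_sum => k _ /=.
have [lt_kb|le_bk] := ltnP (mdeg k) b; first by rewrite pb // scale0r mul0r.
rewrite mulr_algl; apply/msordZ/(msord_le le_bk); exact: msord_prod.
Qed.

(** As no [tnth h i] has a constant term, monomials of degree at least [b] contribute nothing below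
    order [b]; substitution is thus a limit of polynomial evaluations. *)
Lemma mscomp_truncE f b :
  msord b (mscomp h f - mspoly_comp (mstrunc b f)).
Proof.
have truncE j : mspoly_comp (mstrunc j f) =
    \sum_(k : 'X_{1..n < j})
       f k *: (\prod_(i < n) tnth h i ^+ (k : 'X_{1..n}) i).
  rewrite /mspoly_comp raddf_sum; apply: eq_bigr => k _.
  by rewrite /= mmapZ mmapX /= mulr_algl.
move=> m lt_mb; apply/eqP; rewrite msBE subr_eq0; apply/eqP.
transitivity (mspoly_comp (mstrunc (mdeg m).+1 f) m).
  by rewrite truncE ms_sumE; apply: eq_bigr => k _; rewrite msZE.
apply/eqP; rewrite -subr_eq0 -msBE -raddfB.
apply/eqP/(@msord_poly_comp (mdeg m).+1) => // k lt_km.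
by rewrite mcoeffB !mstruncE ?subrr // (leq_trans lt_km).
Qed.

Lemma mscomp_poly p : mscomp h (mspoly p) = mspoly_comp p.
Proof.
apply: msord_lt_eq => b.
rewrite -[X in X - _](subrK (mspoly_comp (mstrunc b (mspoly p)))) -addrA.
apply: msordD; first exact: mscomp_truncE.
rewrite -raddfB; apply: msord_poly_comp => k lt_kb.
by rewrite mcoeffB mstruncE // subrr.
Qed.

Lemma mscompXi i : mscomp h (msX i) = tnth h i.
Proof.
by rewrite -mspolyXU mscomp_poly /mspoly_comp mmapX mmap1U.
Qed.

Lemma mscomp1 : mscomp h 1 = 1.
Proof.
by rewrite -[1](rmorph1 (@mspoly n R)) mscomp_poly /mspoly_comp rmorph1.
Qed.

Lemma mscompM f g : mscomp h (f * g) = mscomp h f * mscomp h g.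
Proof.
apply: msord_lt_eq => b; pose T (e : {mseries R[n]}) := mstrunc b e.
pose P := mspoly_comp.
have -> : mscomp h (f * g) - mscomp h f * mscomp h g =
    mscomp h (f * g - mspoly (T f * T g))
    - ((mscomp h f - P (T f)) * mscomp h g
       + P (T f) * (mscomp h g - P (T g))).
  rewrite mscompB mscomp_poly [mspoly_comp _](rmorphM (mmap _ _)) -/P.
  by rewrite -!/(mspoly_comp _) -!/(P _); ring.
have comp_ord e : msord b (mscomp h e - P (T e)) by exact: mscomp_truncE.
apply: msordB.
  apply: msord_comp => m lt_mb; rewrite msBE [X in X - _](msmulE _ _ lt_mb).
  by rewrite subrr.
by apply: msordD; [rewrite -[b]addn0|rewrite -[b]add0n]; apply: msordM.
Qed.

Lemma mscompX f k : mscomp h (f ^+ k) = mscomp h f ^+ k.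
Proof.
by elim: k => [|k IHk]; rewrite ?mscomp1 // !exprS mscompM IHk.
Qed.

(* Both sides are continuous in f, so it suffices to treat polynomials. *)
Lemma msderiv_comp j f :
  msderiv j (mscomp h f) =
    \sum_(i < n) mscomp h (msderiv i f) * msderiv j (tnth h i).
Proof.
(* [D] measures the failure of the chain rule. It is linear, and its kernel is closed under products
   and contains 1 and the variables, hence all polynomials. *)
pose D e : {mseries R[n']} := msderiv j (mscomp h e)
  - \sum_(i < n) mscomp h (msderiv i e) * msderiv j (tnth h i).
have DE e : D e = 0 -> msderiv j (mscomp h e) =
    \sum_(i < n) mscomp h (msderiv i e) * msderiv j (tnth h i).
  by move/eqP; rewrite subr_eq0 => /eqP.
have DB e e' : D (e - e') = D e - D e'.
  rewrite /D mscompB msderivD msderivN.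
  under eq_bigr => i _ do rewrite msderivD msderivN mscompB mulrBl.
  by rewrite sumrB; ring.
have D0 : D 0 = 0 by have := DB 0 0; rewrite !subrr.
have DD e e' : D (e + e') = D e + D e'.
  by rewrite -[e' in LHS]opprK DB -[- e' in LHS]sub0r DB D0; ring.
have DZ c e : D (c *: e) = c *: D e.
  rewrite /D mscompZ msderivZ scalerBr scaler_sumr; congr (_ - _).
  by apply: eq_bigr => i _; rewrite msderivZ mscompZ msZAl.
have DM e e' : D e = 0 -> D e' = 0 -> D (e * e') = 0.
  move=> /DE De /DE De'; apply/eqP; rewrite /D mscompM msderivM De De'.
  rewrite subr_eq0 mulr_suml mulr_sumr -big_split; apply/eqP/eq_bigr => i _ /=.
  by rewrite msderivM mscompD !mscompM; ring.
have D1 : D 1 = 0.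
  rewrite /D mscomp1 msderiv1 big1 ?subrr // => i _.
  by rewrite msderiv1 mscomp0 mul0r.
have DX i : D (msX i) = 0.
  rewrite /D mscompXi (bigD1 i) //= msderivX eqxx mscomp1 mul1r big1 ?addr0.
    by rewrite subrr.
  by move=> l /negPf ne_li; rewrite msderivX ne_li mscomp0 mul0r.
have Dpoly p : D (mspoly p) = 0.
  elim/mpolyind: p => [|c m p _ _ Dp].
    by rewrite rmorph0.
  rewrite rmorphD DD Dp addr0 /= mspolyZ DZ mpolyXE_id rmorph_prod /=.
  suff ->: D (\prod_(i < n) mspoly ('X_i ^+ m i)) = 0 by rewrite scaler0.
  apply: (big_ind (fun e => D e = 0)) => // i _; rewrite rmorphXn /= mspolyXU.
  by elim: (m i) => [|k IHk]; rewrite ?expr0 // exprS; apply: DM.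
apply: DE; apply: msord_lt_eq => b; rewrite subr0.
(* Truncation at [b.+1] rather than [b], because differentiation loses one order. *)
have -> : D f = D (f - mspoly (mstrunc b.+1 f)) by rewrite DB Dpoly subr0.
have := @mstrunc_ord _ _ b.+1 f; move: (f - _) => e eb.
apply: msordB; first by apply: msord_deriv; apply: msord_comp.
apply: msord_sum => i _; rewrite -[b]addn0; apply: msordM => //.
by apply: msord_comp; apply: msord_deriv.
Qed.

End Composition.

(** * Leading terms and planar monomials *)

(** At a monomial of degree below [k], [mssum] leaves out the index [k]; the order assumed on [F k]
    makes this omission harmless. *)
Lemma mssum_lead (n : nat) (R : comNzRingType) (F : nat -> {mseries R[n]}) b k :
    (0 < k)%N -> (forall j, (j < k)%N -> F j = 0) -> msord k (F k) ->
    (forall j, (k < j)%N -> msord b (F j)) ->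
  msord b (mssum F - F k).
Proof.
move=> k_gt0 Flt Fk Fgt m lt_mb; rewrite msBE /mssum.
have Fj0 j : j != k -> F j m = 0.
  by rewrite neq_ltn => /orP[/Flt -> //|/Fgt ->].
have [lt_mk|le_km] := ltnP (mdeg m) k.
  rewrite Fk // subr0 big_nat big1 // => j /andP[_ lt_jm].
  by rewrite Fj0 // neq_ltn (leq_trans lt_jm).
rewrite (bigD1_seq k) ?iota_uniq ?mem_index_iota ?k_gt0 //=.
by rewrite big1 ?addr0 ?subrr // => j; exact: Fj0.
Qed.

Lemma msord_linXM (n : nat) (R : comNzRingType) (i k : 'I_n)
    (xi eta : {mseries R[n]}) a b :
    msord 2 (xi - msX i) -> msord 2 (eta - msX k) ->
  msord (a + b).+1 (xi ^+ a * eta ^+ b - msX i ^+ a * msX k ^+ b).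
Proof.
move=> xi1 eta1; apply: msord_eqM.
- by rewrite -[X in msord X]muln1; apply: msordX; exact: msordXi.
- by rewrite -[X in msord X.+1]muln1; apply: msord_eqX => //; exact: msordXi.
- rewrite -[X in msord X]muln1; apply/msordX/(msord_eq (@msordXi _ _ k)) => //.
- by rewrite -[X in msord X.+1]muln1; apply: msord_eqX => //; exact: msordXi.
Qed.

Section PlanarMonomials.
Context (R : comNzRingType).

Definition mn2 (a b : nat) : 'X_{1..2} := [multinom [:: a; b]%N].

Lemma mn2E0 a b : mn2 a b 0 = a.
Proof. by rewrite multinomE (tnth_nth 0%N). Qed.

Lemma mn2E1 a b : mn2 a b 1 = b.
Proof. by rewrite multinomE (tnth_nth 0%N). Qed.

Lemma mdeg2E (m : 'X_{1..2}) : mdeg m = (m 0%R + m 1%R)%N.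
Proof.
rewrite mdegE !big_ord_recl big_ord0 addn0.
by congr (m _ + m _)%N; apply: val_inj.
Qed.

Lemma mn2K (m : 'X_{1..2}) : mn2 (m 0) (m 1) = m.
Proof.
apply/mnmP => i; case: i => -[|[|//]] lt_i.
- by rewrite (_ : Ordinal _ = 0) ?mn2E0 //; apply: val_inj.
- by rewrite (_ : Ordinal _ = 1) ?mn2E1 //; apply: val_inj.
Qed.

Lemma mdeg_mn2 a b : mdeg (mn2 a b) = (a + b)%N.
Proof. by rewrite mdeg2E mn2E0 mn2E1. Qed.

Lemma msX2E a b m :
  ((msX 0 : {mseries R[2]}) ^+ a * msX 1 ^+ b) m = (m == mn2 a b)%:R.
Proof.
rewrite -msX_prodE !big_ord_recl big_ord0 mulr1.
have -> : lift ord0 ord0 = 1 :> 'I_2 by apply: val_inj.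
have -> : ord0 = 0 :> 'I_2 by apply: val_inj.
by rewrite mn2E0 mn2E1.
Qed.

End PlanarMonomials.

(** * Resonance for planar fields with linear part z d/dz - w d/dw *)

Section PlanarField.
Context (R : realType).
Local Notation C := R[i].
Variables Z W : {mseries C[2]}.
Hypothesis Z1 : msord 2 (Z - msX 0).
Hypothesis W1 : msord 2 (W - msX 1).
Local Notation X := (ddT2 Z W).
Implicit Types (f g D : {mseries C[2]}).

Lemma ddT2D f g : X (f + g) = X f + X g.
Proof. by rewrite /ddT2 !msderivD; ring. Qed.

Lemma ddT2N f : X (- f) = - X f.
Proof. by rewrite /ddT2 !msderivN; ring. Qed.

Lemma ddT2Z c f : X (c *: f) = c *: X f.
Proof. by rewrite /ddT2 !msderivZ -!msZAl -scalerBr. Qed.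

Lemma ddT2M f g : X (f * g) = X f * g + f * X g.
Proof. by rewrite /ddT2 !msderivM; ring. Qed.

Lemma ddT2_1 : X 1 = 0.
Proof. by rewrite /ddT2 !msderiv1; ring. Qed.

Lemma ddT2_sum (I : Type) (r : seq I) (P : pred I) (F : I -> {mseries C[2]}) :
  X (\sum_(i <- r | P i) F i) = \sum_(i <- r | P i) X (F i).
Proof.
apply: (big_morph _ ddT2D); apply: (addrI (X 0)).
by rewrite -ddT2D !addr0.
Qed.

(** The nonlinear part of the field raises the order, so on lowest-degree terms only its diagonal
    linear part acts. *)
Lemma ddT2_lead k D m : msord k D -> (mdeg m <= k)%N ->
  X D m = ((m 0)%:R - (m 1)%:R) * D m.
Proof.
move=> Dk le_mk.
have -> : X D = msderiv 0 D * msX 0 - msderiv 1 D * msX 1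
    + (msderiv 0 D * (Z - msX 0) - msderiv 1 D * (W - msX 1)).
  by rewrite /ddT2; ring.
rewrite msDE msBE !msderivMX_E mulrBl !mulr_natl.
rewrite [X in _ + X = _](_ : _ = 0) ?addr0 //.
suff h i E : msord 2 E -> msord k.+1 (msderiv i D * E).
  by apply: (@msordB _ _ k.+1); rewrite ?ltnS //; exact: h.
(* At order 0 differentiation has no order to lose, so [msord_deriv] does not apply; the factor [E]
   alone gives enough. *)
case: k Dk {le_mk} => [|k] Dk E2.
  by apply: (@msord_le _ _ _ (0 + 2)) => //; apply: msordM.
by rewrite -[k.+2]addn2; apply: msordM => //; exact: msord_deriv.
Qed.

Section Resonance.
Variables (xi eta : {mseries C[2]}) (M : nat).
Hypothesis xi1 : msord 2 (xi - msX 0).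
Hypothesis eta1 : msord 2 (eta - msX 1).
Hypothesis Xxi : msord M.+1 (X xi - xi).
Hypothesis Xeta : msord M.+1 (X eta + eta).

(** By the Leibniz rule eigenvalues add, and the error stays [M] orders beyond the order of the
    product. *)
Lemma eigenM e e' a b f g : msord e f -> msord e' g ->
    msord (M + e) (X f - a *: f) -> msord (M + e') (X g - b *: g) ->
  msord (M + (e + e')) (X (f * g) - (a + b) *: (f * g)).
Proof.
move=> fe ge' Xf Xg.
have -> : X (f * g) - (a + b) *: (f * g) =
    (X f - a *: f) * g + f * (X g - b *: g).
  rewrite ddT2M scalerDl !mulrBl !mulrBr -msZAl.
  by rewrite -[f * (b *: g)]mulrC -msZAl [g * f]mulrC; ring.
apply: msordD; first by rewrite addnA; apply: msordM.
by rewrite addnCA; apply: msordM.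
Qed.

Lemma eigenX a f k : msord 1 f -> msord (M + 1) (X f - a *: f) ->
  msord (M + k) (X (f ^+ k) - (a *+ k) *: f ^+ k).
Proof.
move=> f1 Xf; elim: k => [|k IHk].
  by rewrite expr0 ddT2_1 scale0r subrr.
rewrite exprS mulrS -[k.+1]add1n; apply: eigenM => //.
by rewrite -[X in msord X]muln1; apply: msordX.
Qed.

Lemma eigen_monomial a b :
  msord (M + (a + b))
    (X (xi ^+ a * eta ^+ b) - (a%:R - b%:R) *: (xi ^+ a * eta ^+ b)).
Proof.
have xi_1 : msord 1 xi by apply: (msord_eq (@msordXi _ _ 0)).
have eta_1 : msord 1 eta by apply: (msord_eq (@msordXi _ _ 1)).
apply: eigenM.
- by rewrite -[X in msord X]muln1; apply: msordX.
- by rewrite -[X in msord X]muln1; apply: msordX.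
- by apply: eigenX => //; rewrite scale1r addn1.
- by rewrite -mulNrn; apply: eigenX => //; rewrite scaleN1r opprK addn1.
Qed.

(* Order by order, the lowest terms of [D] are resonant, hence removed by a   *)
(* combination of monomials in [xi], [eta], which are eigenvectors up to high *)
(* order.                                                                     *)
Lemma eigen_obstruction (lam : C) D m :
    msord 2 D -> msord M.+1 (X D - lam *: D) ->
    mdeg m = M.+1 -> lam = (m 0)%:R - (m 1)%:R ->
  (X D - lam *: D) m = 0.
Proof.
move=> D2 XD deg_m def_lam; pose L f := X f - lam *: f.
have LB f g : L (f - g) = L f - L g.
  by rewrite /L ddT2D ddT2N scalerBr; ring.
have [M0|M_gt0] := posnP M.
  by rewrite msBE (ddT2_lead D2) ?deg_m ?M0 // -def_lam msZE subrr.
(* [D] can be replaced by a series of order [k] without changing its image under [L] up to degree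
   [M.+1]. *)
have red k : (2 <= k <= M.+1)%N ->
    exists2 D', msord k D' & msord M.+2 (L D - L D').
  elim: k => [|k IHk] // /andP[]; rewrite leq_eqVlt => /predU1P[<- _|].
    by exists D => //; rewrite subrr.
  rewrite ltnS => k_ge2 lt_kM; have [|D' D'k LD'] := IHk.
    by rewrite k_ge2 ltnW.
  pose E (i : 'I_k.+1) := xi ^+ i * eta ^+ (k - i).
  pose c (i : 'I_k.+1) := D' (mn2 i (k - i)).
  have addik (i : 'I_k.+1) : (i + (k - i) = k)%N by rewrite subnKC // -ltnS.
  (* Here [k <= M], so [L D'] has no term of degree [k], whereas [L] multiplies each of the lowest
     coefficients of [D'] by an eigenvalue minus [lam]. *)
  have res i : c i = 0 \/ lam = (i : nat)%:R - (k - i)%:R.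
    have : L D' (mn2 i (k - i)) = 0.
      have -> : L D' = L D - (L D - L D') by ring.
      apply: (@msordB _ _ k.+1); rewrite ?mdeg_mn2 ?addik //.
        by apply: msord_le XD.
      by apply: msord_le LD'; apply: leqW.
    rewrite /L msBE msZE (ddT2_lead D'k) ?mdeg_mn2 ?addik // mn2E0 mn2E1.
    rewrite -mulrBl -/(c i) => /eqP; rewrite mulf_eq0 subr_eq0.
    by case/orP => /eqP ->; [right|left].
  exists (D' - \sum_i c i *: E i).
    have Ek i : msord k.+1 (E i - msX 0 ^+ i * msX 1 ^+ (k - i)).
      by rewrite -[k in msord k.+1](addik i); apply: msord_linXM.
    have -> : D' - \sum_i c i *: E i =
        (D' - \sum_(i < k.+1) c i *: (msX 0 ^+ i * msX 1 ^+ (k - i)))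
        - \sum_i c i *: (E i - msX 0 ^+ i * msX 1 ^+ (k - i)).
      under [X in _ = _ - X]eq_bigr => i _ do rewrite scalerBr.
      by rewrite sumrB opprB addrA subrK.
    apply: msordB; last by apply: msord_sum => i _; apply: msordZ.
    move=> l; rewrite ltnS leq_eqVlt => /predU1P[deg_l|lt_lk].
      have lt_l0 : (l 0%R < k.+1)%N by rewrite -deg_l mdeg2E ltnS leq_addr.
      have def_l1 : l 1 = (k - l 0%R)%N by rewrite -deg_l mdeg2E addKn.
      rewrite msBE ms_sumE (bigD1 (Ordinal lt_l0)) //= big1 => [|i ne_i].
        by rewrite addr0 msZE msX2E /c /= -def_l1 mn2K eqxx mulr1 subrr.
      rewrite msZE msX2E; case: eqP => [def_l|_]; last by rewrite mulr0.
      by case/eqP: ne_i; apply: val_inj; rewrite /= def_l mn2E0.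
    rewrite msBE D'k // ms_sumE big1 ?subrr // => i _.
    rewrite msZE msX2E; case: eqP => [def_l|_]; last by rewrite mulr0.
    by move: lt_lk; rewrite def_l mdeg_mn2 addik ltnn.
  rewrite LB opprB addrA [L D + _]addrC -addrA.
  apply: msordD => //; rewrite /L ddT2_sum scaler_sumr -sumrB.
  apply: msord_sum => i _; rewrite ddT2Z scalerA mulrC -scalerA -scalerBr.
  have [->|->] := res i; first by rewrite scale0r.
  (* The error has order [M + k], which is at least [M.+2] because [k >= 2]. *)
  apply/msordZ/msord_le/eigen_monomial; rewrite addik; lia.
have [|D' D'M LD'] := red M.+1; first by rewrite leqnn andbT.
have -> : X D - lam *: D = L D - L D' + L D' by rewrite subrK.
rewrite msDE LD' ?deg_m // add0r /L msBE msZE (ddT2_lead D'M) ?deg_m //.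
by rewrite -def_lam subrr.
Qed.

End Resonance.
End PlanarField.

(** * Restriction to the center manifold *)

Section CenterManifold.
Context (R : realType).
Local Notation C := R[i].
Variables (Z W U : {mseries C[3]}) (ut : {mseries C[2]}).
Hypothesis hut : center_manifold Z W U ut.
Implicit Types f : {mseries C[3]}.

Local Notation h := [tuple msX 0; msX 1; ut].

Lemma msord_center : msord 2 ut.
Proof. by have [/eq_linE + _] := hut; rewrite subr0. Qed.

Lemma msord_chart i : msord 1 (tnth h i).
Proof.
case: i => -[|[|[|k]]] lt_i //; rewrite (tnth_nth 0) /=; [exact: msordXi..|].
exact: msord_le msord_center.
Qed.

Lemma on_manifold0 : on_manifold ut (msX 0) = msX 0.
Proof. by rewrite /on_manifold (mscompXi msord_chart) (tnth_nth 0). Qed.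

Lemma on_manifold1 : on_manifold ut (msX 1) = msX 1.
Proof. by rewrite /on_manifold (mscompXi msord_chart) (tnth_nth 0). Qed.

(** The chain rule produces the derivative of [ut] along the reduced field, and the invariance
    equation of the manifold says that this is the restriction of [U]. *)
Lemma ddT2_on_manifold f :
  ddT2 (on_manifold ut Z) (on_manifold ut W) (on_manifold ut f) =
    on_manifold ut (ddT3 Z W U f).
Proof.
have sum3 (F : 'I_3 -> {mseries C[2]}) :
    \sum_(i < 3) F i = F 0 + F 1 + F (inord 2).
  rewrite !big_ord_recl big_ord0 addr0 addrA.
  by congr (F _ + F _ + F _); apply: val_inj; rewrite //= inordK.
have two3 : inord 2 = 2 :> 'I_3 by apply: val_inj; rewrite /= inordK.
have chain j : msderiv j (on_manifold ut f) =
    on_manifold ut (msderiv 0 f) * msderiv j (msX 0)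
    + on_manifold ut (msderiv 1 f) * msderiv j (msX 1)
    + on_manifold ut (msderiv 2 f) * msderiv j ut.
  by rewrite /on_manifold (msderiv_comp msord_chart) sum3 two3 !(tnth_nth 0).
have -> : on_manifold ut (ddT3 Z W U f) =
    on_manifold ut (msderiv 0 f) * on_manifold ut Z
    - on_manifold ut (msderiv 1 f) * on_manifold ut W
    + on_manifold ut (msderiv 2 f) * on_manifold ut U.
  by rewrite /on_manifold mscompD mscompB !(mscompM msord_chart).
have [_ <-] := hut; rewrite /ddT2 !chain !msderivX /=; ring.
Qed.

End CenterManifold.

(** * Linear part of the concomitant system *)

Section Concomitant.
Context (R : realType).
Local Notation C := R[i].
Variables X Y : {mseries R[3]}.
Hypothesis hX : eq_lin X (- msX 1).
Hypothesis hY : eq_lin Y (msX 0).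

Lemma complexify_lin (f g : {mseries R[3]}) :
  eq_lin f g -> eq_lin (complexify f) (complexify g).
Proof. by move=> fg m lt_m2; rewrite /complexify fg. Qed.

Lemma complexify_msX i : complexify (msX i : {mseries R[3]}) = msX i.
Proof. by apply: msP => m; rewrite /complexify /msX rmorph_nat. Qed.

Lemma complexifyN (f : {mseries R[3]}) : complexify (- f) = - complexify f.
Proof. by apply: msP => m; rewrite /complexify !msNE rmorphN. Qed.

Local Notation x := ((2%:R)^-1 *: (msX 0 + msX 1) : {mseries C[3]}).
Local Notation y := ((2%:R * 'i)^-1 *: (msX 0 - msX 1) : {mseries C[3]}).
Local Notation h := [tuple x; y; msX 2].

Lemma msord_zwu i : msord 1 (tnth h i).
Proof.
case: i => -[|[|[|k]]] lt_i //; rewrite (tnth_nth 0) /=.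
- by apply/msordZ/msordD; exact: msordXi.
- by apply/msordZ/msordB; exact: msordXi.
- exact: msordXi.
Qed.

Lemma to_zwu_lin (f g : {mseries R[3]}) :
  eq_lin f g -> msord 2 (to_zwu f - to_zwu g).
Proof.
move=> /complexify_lin/eq_linE fg; rewrite /to_zwu -mscompB.
exact: msord_comp.
Qed.

Lemma to_zwu_X : msord 2 (to_zwu X + y).
Proof.
have := to_zwu_lin hX; rewrite /to_zwu complexifyN complexify_msX mscompN.
by rewrite (mscompXi msord_zwu) (tnth_nth 0) /= opprK.
Qed.

Lemma to_zwu_Y : msord 2 (to_zwu Y - x).
Proof.
have := to_zwu_lin hY; rewrite /to_zwu complexify_msX.
by rewrite (mscompXi msord_zwu) (tnth_nth 0).
Qed.

Lemma invr_2i : (2%:R * 'i)^-1 = - 'i / 2%:R :> C.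
Proof.
apply: mulr1_eq; have two_neq0 : 2%:R != 0 :> C by rewrite pnatr_eq0.
by rewrite mulrA -[_ * 'i * _]mulrA mulrN -expr2 sqrCi opprK mulr1 divff.
Qed.

(** To first order the right-hand side is -i(-y + ix) = x + iy = z. *)
Lemma concZ_lin : msord 2 (concZ X Y - msX 0).
Proof.
have -> : concZ X Y - msX 0 =
    - 'i *: ((to_zwu X + y) + 'i *: (to_zwu Y - x)).
  apply: msP => m; rewrite /concZ !(msBE, msDE, msZE) invr_2i.
  by field: (@sqrCi C).
by apply/msordZ/msordD; [exact: to_zwu_X|apply/msordZ; exact: to_zwu_Y].
Qed.

Lemma concW_lin : msord 2 (concW X Y - msX 1).
Proof.
have -> : concW X Y - msX 1 =
    'i *: ((to_zwu X + y) - 'i *: (to_zwu Y - x)).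
  apply: msP => m; rewrite /concW !(msDE, msNE, msZE) invr_2i.
  by field: (@sqrCi C).
by apply/msordZ/msordB; [exact: to_zwu_X|apply/msordZ; exact: to_zwu_Y].
Qed.

End Concomitant.

(** * Leading terms of the resonant sums *)

Section ResonantSums.
Context (n : nat) (R : comNzRingType) (i k : 'I_n) (c : nat -> R) (N : nat).
Hypothesis N_gt0 : (0 < N)%N.
Hypothesis c0 : forall j, (j < N)%N -> c j = 0.

(** The terms with [j > N] start in degree 2j + 1 > 2N + 2, and in the term [N] replacing [a], [b]
    by their linear parts costs only degree 2N + 2 and higher. *)
Lemma normal_sum_lead (a b : {mseries R[n]}) :
    msord 2 (a - msX i) -> msord 2 (b - msX k) ->
  msord N.*2.+2 (mssum (fun j => c j *: (a ^+ j.+1 * b ^+ j))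
    - c N *: (msX i ^+ N.+1 * msX k ^+ N)).
Proof.
move=> a1 b1; pose F j := c j *: (a ^+ j.+1 * b ^+ j).
have ab j : msord j.*2.+1 (a ^+ j.+1 * b ^+ j).
  rewrite -addnn -addSn; apply: msordM.
    by rewrite -[X in msord X]muln1; apply/msordX/(msord_eq (@msordXi _ _ i)).
  by rewrite -[X in msord X]muln1; apply/msordX/(msord_eq (@msordXi _ _ k)).
have -> : mssum F - c N *: (msX i ^+ N.+1 * msX k ^+ N) = (mssum F - F N)
    + c N *: (a ^+ N.+1 * b ^+ N - msX i ^+ N.+1 * msX k ^+ N).
  by rewrite scalerBr addrA subrK.
apply: msordD.
  apply: mssum_lead => // [j lt_jN||j lt_Nj].
  - by rewrite /F c0 // scale0r.
  - by apply/msordZ/msord_le/ab; rewrite -addnn leqW // leq_addr.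
  - by apply/msordZ/msord_le/ab; lia.
by apply: msordZ; rewrite -addnn -addSn; apply: msord_linXM.
Qed.

Lemma msX_sum_lead (l : 'I_n) :
  msord N.*2.+2 (msX l * mssum (fun j => c j *: (msX i * msX k) ^+ j)
    - c N *: (msX l * (msX i * msX k) ^+ N)).
Proof.
pose F j : {mseries R[n]} := c j *: (msX i * msX k) ^+ j.
have Xj j : msord j.*2 ((msX i * msX k : {mseries R[n]}) ^+ j).
  by rewrite -muln2; apply/msordX/(@msordM _ _ 1 1); exact: msordXi.
have -> : msX l * mssum F - c N *: (msX l * (msX i * msX k) ^+ N) =
    msX l * (mssum F - F N).
  by rewrite mulrBr /F -[msX l * (_ *: _)]mulrC -msZAl [_ ^+ N * _]mulrC.
rewrite -[_.+2]add0n; apply: msordM => //.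
apply: mssum_lead => // [j lt_jN||j lt_Nj].
- by rewrite /F c0 // scale0r.
- by apply/msordZ/msord_le/Xj; rewrite -addnn leq_addr.
- by apply/msordZ/msord_le/Xj; lia.
Qed.

End ResonantSums.

(** * The first nonvanishing normal form constants are intrinsic *)

Section NormalForm.
Context (R : realType).
Local Notation C := R[i].
Variables (Z W : {mseries C[2]}) (p q : nat -> C).
Hypothesis Z1 : msord 2 (Z - msX 0).
Hypothesis W1 : msord 2 (W - msX 1).
Hypothesis hpq : normal_form_constants Z W p q.
Variable n : nat.
Hypothesis n_gt0 : (0 < n)%N.
Hypothesis pq0 : forall j, (j < n)%N -> p j = 0 /\ q j = 0.

Local Notation zw a b := (msX 0 ^+ a * msX 1 ^+ b : {mseries C[2]}).

Lemma msord_zw a b : msord (a + b) (zw a b).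
Proof.
move=> m lt_m; rewrite msX2E; case: eqP => // def_m.
by move: lt_m; rewrite def_m mdeg_mn2 ltnn.
Qed.

Lemma normal_form_lead : exists xi eta : {mseries C[2]},
  [/\ msord 2 (xi - msX 0), msord 2 (eta - msX 1),
      msord n.*2.+2 (ddT2 Z W xi - xi - p n *: zw n.+1 n) &
      msord n.*2.+2 (ddT2 Z W eta + eta + q n *: zw n n.+1)].
Proof.
case: hpq => _ [_ [xi [eta [[/eq_linE xi1 /eq_linE eta1] _ _ Xxi Xeta]]]].
exists xi, eta; split; rewrite ?Xxi ?Xeta //.
  rewrite [xi + _]addrC addrK; apply: normal_sum_lead => // j lt_jn.
  by case: (pq0 lt_jn).
rewrite [- eta - _]addrC subrK addrC -opprB.
apply: msordN; rewrite [zw _ _]mulrC; apply: normal_sum_lead => // j lt_jn.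
by case: (pq0 lt_jn).
Qed.

Lemma msord_lead_zw (f : {mseries C[2]}) c a b : (a + b = n.*2.+1)%N ->
  msord n.*2.+2 (f - c *: zw a b) -> msord n.*2.+1 f.
Proof.
move=> ab fc; rewrite -(subrK (c *: zw a b) f); apply: msordD.
  exact: msord_le fc.
by apply: msordZ; rewrite -ab; exact: msord_zw.
Qed.

(** A nonzero multiple of the resonant monomial is not in the image of X - [lam] on series of order
    2, modulo degree 2n + 2: [eigen_obstruction] with [M] equal to 2n. *)
Lemma normal_form_unique lam a b (D : {mseries C[2]}) c :
    (a + b = n.*2.+1)%N -> lam = a%:R - b%:R ->
    msord 2 D -> msord n.*2.+2 (ddT2 Z W D - lam *: D - c *: zw a b) ->
  c = 0.
Proof.
move=> ab def_lam D2 XD.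
have [xi [eta [xi1 eta1 Xxi Xeta]]] := normal_form_lead.
have := @eigen_obstruction _ _ _ Z1 W1 xi eta n.*2 xi1 eta1 _ _ lam D (mn2 a b).
rewrite mdeg_mn2 mn2E0 mn2E1 => obstr.
have := XD (mn2 a b); rewrite mdeg_mn2 ab msBE obstr //.
- rewrite msZE msX2E eqxx mulr1 sub0r => /(_ (leqnn _))/eqP.
  by rewrite oppr_eq0 => /eqP.
- by apply: msord_lead_zw Xxi; rewrite addSn addnn.
- apply: (@msord_lead_zw _ (- q n) n n.+1); first by rewrite addnS addnn.
  by rewrite scaleNr opprK.
- exact: msord_lead_zw XD.
Qed.

Lemma normal_form_p (F : {mseries C[2]}) (c : C) :
    msord 2 (F - msX 0) ->
    msord n.*2.+2 (ddT2 Z W F - F - c *: zw n.+1 n) ->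
  p n = c.
Proof.
move=> F1 XF; have [xi [eta [xi1 _ Xxi _]]] := normal_form_lead.
apply/eqP; rewrite -subr_eq0; apply/eqP.
apply: (@normal_form_unique 1 n.+1 n (xi - F)).
- by rewrite addSn addnn.
- by rewrite -addn1 natrD addrC addKr.
- have -> : xi - F = (xi - msX 0) - (F - msX 0) by ring.
  exact: msordB.
- rewrite ddT2D ddT2N scale1r scalerBl.
  set A := p n *: _; set B := c *: _.
  have -> : ddT2 Z W xi - ddT2 Z W F - (xi - F) - (A - B) =
      (ddT2 Z W xi - xi - A) - (ddT2 Z W F - F - B) by ring.
  exact: msordB.
Qed.

Lemma normal_form_q (F : {mseries C[2]}) (c : C) :
    msord 2 (F - msX 1) ->
    msord n.*2.+2 (ddT2 Z W F + F + c *: zw n n.+1) ->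
  q n = c.
Proof.
move=> F1 XF; have [xi [eta [_ eta1 _ Xeta]]] := normal_form_lead.
apply/eqP; rewrite eq_sym -subr_eq0; apply/eqP.
(* The constants enter with a minus sign, so [eta - F] yields [c - q n], whence the swap by
   [eq_sym]. *)
apply: (@normal_form_unique (-1) n n.+1 (eta - F)).
- by rewrite addnS addnn.
- by rewrite -addn1 natrD opprD addrA subrr add0r.
- have -> : eta - F = (eta - msX 1) - (F - msX 1) by ring.
  exact: msordB.
- rewrite ddT2D ddT2N scaleN1r scalerBl.
  set A := q n *: _; set B := c *: _.
  have -> : ddT2 Z W eta - ddT2 Z W F - - (eta - F) - (B - A) =
      (ddT2 Z W eta + eta + A) - (ddT2 Z W F + F + B) by ring.
  exact: msordB.
Qed.

End NormalForm.

(** * Comparison of the planar and spatial constants *)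

Theorem theorem3p3 (R : realType) (d : R) (X Y V : {mseries R[3]})
    (hd : d != 0)
    (hX : eq_lin X (- msX 1)) (hY : eq_lin Y (msX 0))
    (hV : eq_lin V (- d *: msX 2))
    (ut : {mseries R[i][2]})
    (hut : center_manifold (concZ X Y) (concW X Y) (concU V) ut)
    (p q p' q' : nat -> R[i])
    (hpq : normal_form_constants (on_manifold ut (concZ X Y))
                                 (on_manifold ut (concW X Y)) p q)
    (hp' : f_constants (concZ X Y) (concW X Y) (concU V) p')
    (hq' : g_constants (concZ X Y) (concW X Y) (concU V) q') :
  (forall m : nat, (0 < m)%N ->
     (forall j : nat, (j < m)%N -> p j = 0 /\ q j = 0) ->
     (forall j : nat, (j < m)%N -> p' j = 0 /\ q' j = 0) /\
     p m = p' m /\ q m = q' m) /\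
  (forall m : nat, (0 < m)%N ->
     (forall j : nat, (j < m)%N -> p' j = 0 /\ q' j = 0) ->
     (forall j : nat, (j < m)%N -> p j = 0 /\ q j = 0) /\
     p m = p' m /\ q m = q' m) /\
  (isochronous_center X Y V <->
     forall k : nat, (0 < k)%N -> p' k = 0 /\ q' k = 0).
Proof.
(* The manifold and the constants are arbitrary here, since [isochronous_center] brings its own
   witnesses. *)
have same n vt (r s : nat -> R[i]) :
    center_manifold (concZ X Y) (concW X Y) (concU V) vt ->
    normal_form_constants (on_manifold vt (concZ X Y))
                          (on_manifold vt (concW X Y)) r s ->
    (forall j, (j < n)%N -> r j = 0 /\ s j = 0) ->
    (forall j, (j < n)%N -> p' j = 0 /\ q' j = 0) ->
  r n = p' n /\ s n = q' n.
  move=> hvt hrs rs0 pq0'.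
  have [n0|n_gt0] := posnP n.
    by rewrite n0; case: hrs hp' hq' => [-> [-> _]] [-> _] [-> _].
  have Z1 : msord 2 (on_manifold vt (concZ X Y) - msX 0).
    rewrite -(on_manifold0 hvt) /on_manifold -mscompB.
    exact/msord_comp/concZ_lin.
  have W1 : msord 2 (on_manifold vt (concW X Y) - msX 1).
    rewrite -(on_manifold1 hvt) /on_manifold -mscompB.
    exact/msord_comp/concW_lin.
  split.
    have [_ [f [/eq_linE f1 _ eq_f]]] := hp'.
    apply: (normal_form_p Z1 W1 hrs n_gt0 rs0 (F := on_manifold vt f)).
      rewrite -(on_manifold0 hvt) /on_manifold -mscompB.
      exact: msord_comp.
    (* Substitution preserves orders, so the leading-term estimate for the equation of [f] can be
       restricted to the manifold. *)
    have /(@msord_comp _ _ _ [tuple msX 0; msX 1; vt]) :=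
      msX_sum_lead (0 : 'I_3) 1 n_gt0 (fun j lt_jn => proj1 (pq0' j lt_jn)) 0.
    rewrite -eq_f mscompB mscompB mscompZ -!/(on_manifold _ _).
    rewrite -(ddT2_on_manifold hvt) /on_manifold.
    rewrite !(mscompM (msord_chart hvt)) (mscompX (msord_chart hvt)).
    rewrite !(mscompM (msord_chart hvt)) -!/(on_manifold _ _).
    by rewrite (on_manifold0 hvt) (on_manifold1 hvt) exprMn mulrA -exprS.
  have [_ [g [/eq_linE g1 _ eq_g]]] := hq'.
  apply: (normal_form_q Z1 W1 hrs n_gt0 rs0 (F := on_manifold vt g)).
    rewrite -(on_manifold1 hvt) /on_manifold -mscompB.
    exact: msord_comp.
  have /(@msord_comp _ _ _ [tuple msX 0; msX 1; vt]) :=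
    msX_sum_lead (0 : 'I_3) 1 n_gt0 (fun j lt_jn => proj2 (pq0' j lt_jn)) 1.
  move/msordN; rewrite -mscompN opprB addrC -mulNr -eq_g.
  rewrite mscompD mscompD mscompZ -!/(on_manifold _ _).
  rewrite -(ddT2_on_manifold hvt) /on_manifold.
  rewrite !(mscompM (msord_chart hvt)) (mscompX (msord_chart hvt)).
  rewrite !(mscompM (msord_chart hvt)) -!/(on_manifold _ _).
  by rewrite (on_manifold0 hvt) (on_manifold1 hvt) exprMn mulrCA -exprS.
have direct m vt (r s : nat -> R[i]) :
    center_manifold (concZ X Y) (concW X Y) (concU V) vt ->
    normal_form_constants (on_manifold vt (concZ X Y))
                          (on_manifold vt (concW X Y)) r s ->
    (forall j, (j < m)%N -> r j = 0 /\ s j = 0) ->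
  forall j, (j < m)%N -> p' j = 0 /\ q' j = 0.
  (* The induction hypothesis gives the vanishing of [p'], [q'] below [j] that [same] requires. *)
  move=> hvt hrs rs0 j; elim/ltn_ind: j => j IHj lt_jm.
  have lt_m i : (i < j)%N -> (i < m)%N by move/ltn_trans; apply.
  have [i lt_ij|i lt_ij|<- <-] := same j vt r s hvt hrs.
  - exact/rs0/lt_m.
  - exact/IHj/lt_m.
  - exact: rs0.
have converse m : (forall j, (j < m)%N -> p' j = 0 /\ q' j = 0) ->
    forall j, (j < m)%N -> p j = 0 /\ q j = 0.
  move=> pq0' j; elim/ltn_ind: j => j IHj lt_jm.
  have lt_m i : (i < j)%N -> (i < m)%N by move/ltn_trans; apply.
  have [i lt_ij|i lt_ij|-> ->] := same j ut p q hut hpq.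
  - exact/IHj/lt_m.
  - exact/pq0'/lt_m.
  - exact: pq0'.
split; [|split].
- move=> m _ pq0; have pq0' := direct m ut p q hut hpq pq0.
  by split; last exact: same hut hpq pq0 pq0'.
- move=> m _ pq0'; have pq0 := converse m pq0'.
  by split; last exact: same hut hpq pq0 pq0'.
split=> [[vt [hvt [r [s [hrs rs0]]]]] k k_gt0|pq0'].
  (* Isochronicity only speaks of positive indices; index 0 vanishes by convention. *)
  apply: (direct k.+1 vt r s hvt hrs) => // -[|j] _; last exact: rs0.
  by case: hrs => -> [-> _].
exists ut; split=> //; exists p, q; split=> // k k_gt0.
apply: (converse k.+1) => // -[|j] _; last exact: pq0'.
by case: hp' hq' => -> _ [-> _].
Qed.
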